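(* Let $\xi\in(\tfrac13,\tfrac12)$. The link queue model for the diverge-merge network with two intermediate links, $$\frac{dk_1}{dt}=\frac1{L_1}\left(\frac{\xi}{1-\xi}\,s_2(k_2)-d_1(k_1)\right),\qquad \frac{dk_2}{dt}=\frac1{L_2}\left(s_2(k_2)+d_1(k_1)-C_3\right),$$ is asymptotically stable at its stationary states in which link 1 is uncongested and link 2 is congested.
   Context: The network has one origin-destination pair: link 0 diverges into links 1 and 2, which merge into link 3. Link lengths are $L_0=1$, $L_1=1$, $L_2=2$, $L_3=1$ miles, the numbers of lanes are $3,1,2,2$, and $C_3=4680$ vph is the capacity of link 3. $\xi$ is the constant proportion of vehicles using link 1, and $1-\xi$ the proportion using link 2; $k_1,k_2$ are the densities of links 1 and 2. For a link $a$ with unimodal fundamental diagram $Q_a$ maximal at the critical density $k_{a,c}$, the demand is $d_a(k_a)=Q_a(\min\{k_a,k_{a,c}\})$ and the supply is $s_a(k_a)=Q_a(\max\{k_a,k_{a,c}\})$. Link 1 uncongested means $k_1<k_{1,c}$, where $d_1$ is increasing with $\frac{d\,d_1}{dk_1}>0$; link 2 congested means $k_2>k_{2,c}$, where $s_2$ is decreasing with $\frac{d\,s_2}{dk_2}<0$. The displayed system is the form the link queue model takes for such states, under the boundary flux relations $f_1=\frac{\xi}{1-\xi}s_2$, $f_2=s_2$, $g_1=d_1$, $g_2=C_3-d_1$. A stationary state is a pair $(k_1,k_2)$ at which both right-hand sides vanish. *)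

(* Defs.v *)
From Stdlib Require Import Reals.
From Coquelicot Require Import Coquelicot.
Open Scope R_scope.

(** Trajectories on [[0, T)], with [T = p_infty] allowed: continuous from the
    right at the initial time and differentiable afterwards. *)
Definition solution {V : NormedModule R_AbsRing} (F : V -> V) (T : Rbar)
  (x : R -> V) : Prop :=
  filterlim x (at_right 0) (locally (x 0)) /\
  forall t : R, 0 < t -> Rbar_lt t T -> is_derive x t (F (x t)).

Definition stationary_state {V : NormedModule R_AbsRing} (F : V -> V) (p : V)
  : Prop := F p = zero.

(** Trajectories with a finite horizon are included, so that a trajectory
    cannot leave the neighbourhood by blowing up in finite time. *)
Definition lyapunov_stable {V : NormedModule R_AbsRing} (F : V -> V) (p : V)
  : Prop :=
  forall eps : R, 0 < eps -> exists delta : R, 0 < delta /\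
    forall (T : Rbar) (x : R -> V), solution F T x ->
      norm (minus (x 0) p) < delta ->
      forall t : R, 0 <= t -> Rbar_lt t T -> norm (minus (x t) p) < eps.

Definition locally_attractive {V : NormedModule R_AbsRing} (F : V -> V) (p : V)
  : Prop :=
  exists delta : R, 0 < delta /\
    forall x : R -> V, solution F p_infty x ->
      norm (minus (x 0) p) < delta ->
      filterlim x (Rbar_locally p_infty) (locally p).

Definition asymptotically_stable {V : NormedModule R_AbsRing} (F : V -> V)
  (p : V) : Prop :=
  lyapunov_stable F p /\ locally_attractive F p.

(** Flow-density relation on the densities [[0, kj]], with jam density [kj] and
    critical density [kc]; the values of [Q] outside this range are arbitrary.
    Neither continuity nor strict monotonicity is imposed. *)
Record fundamental_diagram (Q : R -> R) (kc kj : R) : Prop := {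
  fd_kc_pos : 0 < kc;
  fd_kc_lt_kj : kc < kj;
  fd_empty : Q 0 = 0;
  fd_jam : Q kj = 0;
  fd_incr : forall x y : R, 0 <= x -> x <= y -> y <= kc -> Q x <= Q y;
  fd_decr : forall x y : R, kc <= x -> x <= y -> y <= kj -> Q y <= Q x
}.

Definition demand (Q : R -> R) (kc k : R) : R := Q (Rmin k kc).

Definition supply (Q : R -> R) (kc k : R) : R := Q (Rmax k kc).

Definition uncongested (kc k : R) : Prop := 0 <= k < kc.

Definition congested (kc kj k : R) : Prop := kc < k <= kj.

(** Lengths in miles, capacity in vehicles per hour. *)
Definition L1 : R := 1.
Definition L2 : R := 2.
Definition C3 : R := 4680.

(** Right-hand side of the model when link 1 is uncongested and link 2 is
    congested: [dk_a/dt = (f_a - g_a) / L_a] with in-fluxes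
    [f_1 = xi / (1 - xi) * s2], [f_2 = s2] and out-fluxes [g_1 = d1],
    [g_2 = C3 - d1]. *)
Definition link_queue_model (xi : R) (d1 s2 : R -> R) (k : R * R) : R * R :=
  (/ L1 * (xi / (1 - xi) * s2 (snd k) - d1 (fst k)),
   / L2 * (s2 (snd k) + d1 (fst k) - C3)).

(* Main.v *)
Require Import Defs.
From Stdlib Require Import Reals Lra.
From Coquelicot Require Import Coquelicot.
Open Scope R_scope.

(** At the stationary state [d1 = xi * C3] and [s2 = (1 - xi) * C3] are both
    positive, so neither density is at an end of its range and the slopes
    [a = d1'(k1) > 0] and [- b = s2'(k2) < 0] are available. With
    [r = xi / (1 - xi)], the linearization has matrix
    [[- a, - r b], [a / 2, - b / 2]], and along it the mixed terms cancel in the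
    derivative of the Lyapunov function
    [V = a / 2 * (x - k1)^2 + r * b * (y - k2)^2], leaving
    [- a^2 (x - k1)^2 - r b^2 (y - k2)^2]. The remainders of [d1] and [s2] are
    small compared with [|x - k1|] and [|y - k2|], so near the stationary state
    [V] still decays exponentially along every trajectory. *)

(** * Differential inequalities on the half-line and exponential decay *)

Lemma nonincreasing_of_derive (g dg : R -> R) (a b : R) :
  a <= b ->
  filterlim g (at_right a) (locally (g a)) ->
  (forall t : R, a < t <= b -> is_derive g t (dg t)) ->
  (forall t : R, a < t < b -> dg t <= 0) ->
  g b <= g a.
Proof.
  intros Hab Hlim Hder Hneg.
  destruct Hab as [Hab | ->]; [ | lra ].
  apply Rnot_lt_le; intros Hlt.
  assert (He : 0 < g b - g a) by lra.
  destruct (Hlim _ (locally_ball (g a) (mkposreal _ He))) as [e Hball].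
  pose proof (cond_pos e) as Hepos.
  (* Only right-continuity is known at [a], so the mean value theorem is applied on [[s, b]], with
     [s] close enough to [a] that [g s < g b] still holds. *)
  set (s := Rmin (a + e / 2) ((a + b) / 2)).
  assert (Hs : a < s < b /\ s <= a + e / 2).
  { unfold s. pose proof (Rmin_l (a + e / 2) ((a + b) / 2)).
    pose proof (Rmin_r (a + e / 2) ((a + b) / 2)).
    assert (a < Rmin (a + e / 2) ((a + b) / 2)) by (apply Rmin_glb_lt; lra).
    lra. }
  assert (Hgs : Rabs (g s - g a) < g b - g a).
  { apply Hball; [ | lra ]. change (Rabs (s - a) < e).
    rewrite Rabs_right; lra. }
  apply Rabs_def2 in Hgs.
  destruct (MVT_cor2 g dg s b) as [c [Hc Hcin]]; [ lra | | ].
  { intros c Hc. apply is_derive_Reals, Hder. lra. }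
  assert (dg c <= 0) by (apply Hneg; lra).
  nra.
Qed.

(** Integrating factor: [W t * exp (c * t)] has derivative [(dW t + c * W t) * exp (c * t) <= 0]
    while [W < rho]. The bound by [rho] is assumed only before [s], so that the conclusion at [s]
    can serve to extend it. *)
Lemma exponential_decay_of_trapped (W dW : R -> R) (c rho s : R) :
  0 <= s ->
  filterlim W (at_right 0) (locally (W 0)) ->
  (forall t : R, 0 < t <= s -> is_derive W t (dW t)) ->
  (forall t : R, W t < rho -> dW t <= - c * W t) ->
  (forall t : R, 0 <= t < s -> W t < rho) ->
  W s <= W 0 * exp (- c * s).
Proof.
  intros Hs Hlim Hder Hdec Htrap.
  assert (H : W s * exp (c * s) <= W 0 * exp (c * 0)).
  { apply (nonincreasing_of_derive (fun t => W t * exp (c * t))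
      (fun t => (dW t + c * W t) * exp (c * t)) 0 s); auto.
    - eapply (filterlim_comp_2 W (fun t => exp (c * t)) Rmult);
        [ exact Hlim | | ].
      + apply (filterlim_filter_le_1 (F := locally 0) (G := at_right 0)).
        { apply filter_le_within. }
        apply (ex_derive_continuous (fun t => exp (c * t))).
        auto_derive. exact I.
      + apply (filterlim_mult (K := R_AbsRing) (W 0) (exp (c * 0))).
    - intros t Ht. pose proof (Hder t Ht) as HW.
      evar_last.
      + apply (is_derive_mult W (fun t => exp (c * t)) t); [ exact HW | | ].
        * auto_derive; [ exact I | reflexivity ].
        * intros; apply Rmult_comm.
      + unfold plus, mult; simpl. ring.
    - intros t Ht. pose proof (Hdec t (Htrap t ltac:(lra))).
      pose proof (exp_pos (c * t)). nra. }
  rewrite Rmult_0_r, exp_0, Rmult_1_r in H.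
  replace (- c * s) with (- (c * s)) by ring.
  rewrite exp_Ropp.
  pose proof (exp_pos (c * s)) as Hp.
  apply Rmult_le_reg_r with (1 := Hp).
  rewrite Rmult_assoc, Rinv_l; lra.
Qed.

Lemma exp_decay_le_1 (c t : R) : 0 <= c -> 0 <= t -> exp (- c * t) <= 1.
Proof.
  intros Hc Ht. rewrite <- exp_0.
  destruct (Req_dec (- c * t) 0) as [-> | Hne]; [ lra | ].
  left. apply exp_increasing. nra.
Qed.

(* The sublevel set [W < rho] is never left: at the supremum of the times up to
   which [W] stays below [rho], decay gives [W <= W 0 < rho]. *)
Lemma exponential_decay (W dW : R -> R) (T : Rbar) (c rho : R) :
  0 <= c ->
  (forall t : R, 0 <= W t) ->
  filterlim W (at_right 0) (locally (W 0)) ->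
  (forall t : R, 0 < t -> Rbar_lt t T -> is_derive W t (dW t)) ->
  (forall t : R, W t < rho -> dW t <= - c * W t) ->
  W 0 < rho ->
  forall t : R, 0 <= t -> Rbar_lt t T -> W t <= W 0 * exp (- c * t).
Proof.
  intros Hc Hpos Hlim Hder Hdec H0.
  assert (HT : forall s t : R, s <= t -> Rbar_lt t T -> Rbar_lt s T).
  { intros s t Hst Ht. apply Rbar_le_lt_trans with (Finite t); auto. }
  assert (Hdecay : forall s : R, 0 <= s -> Rbar_lt s T ->
    (forall u : R, 0 <= u < s -> W u < rho) -> W s <= W 0 * exp (- c * s)).
  { intros s Hs HsT Htrap.
    apply exponential_decay_of_trapped with dW rho; auto.
    intros t Ht. apply Hder; [ lra | apply HT with s; auto; lra ]. }
  assert (Hright : forall s : R, 0 <= s -> Rbar_lt s T ->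
    filterlim W (at_right s) (locally (W s))).
  { intros s [Hs | <-] HsT; [ | exact Hlim ].
    apply (filterlim_filter_le_1 (F := locally s) (G := at_right s)).
    { apply filter_le_within. }
    apply (ex_derive_continuous W). exists (dW s). apply Hder; auto. }
  assert (Htrap : forall t : R, 0 <= t -> Rbar_lt t T -> W t < rho).
  { intros t Ht HtT.
    destruct (completeness (fun tau => 0 <= tau <= t /\
      forall u : R, 0 <= u < tau -> W u < rho)) as [s [Hub Hleast]].
    { exists t. intros tau [Htau _]. lra. }
    { exists 0. split; [ lra | intros; lra ]. }
    assert (Hs0 : 0 <= s) by (apply Hub; split; [ lra | intros; lra ]).
    assert (Hst : s <= t) by (apply Hleast; intros tau [Htau _]; lra).
    assert (HsT : Rbar_lt s T) by (apply HT with t; auto).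
    assert (Hbelow : forall u : R, 0 <= u < s -> W u < rho).
    (* A time [u < s] with [W u >= rho] would itself be an upper bound of the set, below its
       supremum [s]. *)
    { intros u Hu. apply Rnot_le_lt; intros Hle.
      assert (s <= u); [ | lra ].
      apply Hleast. intros tau [Htau Hin]. apply Rnot_lt_le; intros Hlt.
      pose proof (Hin u). lra. }
    assert (HWs : W s < rho).
    { apply Rle_lt_trans with (W 0 * exp (- c * s)); [ auto | ].
      pose proof (exp_decay_le_1 c s Hc Hs0).
      pose proof (Hpos 0). pose proof (exp_pos (- c * s)). nra. }
    destruct Hst as [Hst | <-]; [ | exact HWs ].
    exfalso.
    (* Right-continuity at [s] keeps [W] below [rho] a little longer, so [Rmin (s + e) t] lies in
       the set and exceeds its supremum. *)
    assert (He : 0 < rho - W s) by lra.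
    destruct (Hright s Hs0 HsT _ (locally_ball (W s) (mkposreal _ He)))
      as [e Hball].
    pose proof (cond_pos e) as Hepos.
    assert (Hlater : Rmin (s + e) t <= s); [ | revert Hlater;
      apply Rlt_not_le, Rmin_glb_lt; lra ].
    apply Hub. split.
    { split; [ apply Rmin_glb; lra | apply Rmin_r ]. }
    intros u Hu. pose proof (Rmin_l (s + e) t).
    destruct (Rtotal_order u s) as [Hus | [-> | Hus]];
      [ apply Hbelow; lra | exact HWs | ].
    assert (Hgs : Rabs (W u - W s) < rho - W s).
    { apply Hball; [ | exact Hus ]. change (Rabs (u - s) < e).
      rewrite Rabs_right; lra. }
    apply Rabs_def2 in Hgs. lra. }
  intros t Ht HtT. apply Hdecay; auto.
  intros u Hu. apply Htrap; [ lra | apply HT with t; auto; lra ].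
Qed.

(** * Lyapunov's direct method with a quadratically bounded function *)

Lemma exp_decay_lim (A c : R) :
  0 < c ->
  filterlim (fun t => A * exp (- c * t)) (Rbar_locally p_infty) (locally 0).
Proof.
  intros Hc.
  change (is_lim (fun t => A * exp (- c * t)) p_infty 0).
  replace (Finite 0) with (Rbar_mult A 0) by (simpl; f_equal; ring).
  apply is_lim_scal_l.
  apply is_lim_comp with m_infty; [ exact is_lim_exp_m | | ].
  - replace m_infty with (Rbar_mult (- c) p_infty).
    + apply is_lim_scal_l, is_lim_id.
    + apply is_Rbar_mult_unique, is_Rbar_mult_sym.
      apply is_Rbar_mult_p_infty_neg. simpl. lra.
  - exists 0. intros; discriminate.
Qed.

(** The two-sided bound makes balls around [p] and sublevel sets of [V] comparable, so exponential
    decay of [V] along trajectories gives both stability, on any horizon, and convergence. *)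
Lemma asymptotically_stable_of_quadratic_lyapunov {E : NormedModule R_AbsRing}
  (F : E -> E) (p : E) (V : E -> R) (dV : E -> E -> R) (m M c rho : R) :
  0 < m -> 0 < M -> 0 < c -> 0 < rho ->
  (forall z : E, m * norm (minus z p) ^ 2 <= V z <= M * norm (minus z p) ^ 2) ->
  (forall z : E, filterdiff V (locally z) (dV z)) ->
  (forall z : E, V z < rho -> dV z (F z) <= - c * V z) ->
  asymptotically_stable F p.
Proof.
  intros Hm HM Hc Hrho Hquad Hdiff Hdec.
  assert (Hpos : forall z : E, 0 <= V z).
  { intros z. destruct (Hquad z) as [H _].
    pose proof (pow2_ge_0 (norm (minus z p))). nra. }
  assert (Hsmall : forall r : R, 0 < r -> exists delta : R, 0 < delta /\
    forall z : E, norm (minus z p) < delta -> V z < r).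
  { intros r Hr. exists (sqrt (r / M)).
    assert (HrM : 0 < r / M) by (apply Rdiv_lt_0_compat; auto).
    split; [ apply sqrt_lt_R0; auto | ].
    intros z Hz. destruct (Hquad z) as [_ H].
    pose proof (norm_ge_0 (minus z p)).
    pose proof (sqrt_sqrt (r / M) ltac:(lra)) as Hsq.
    assert (norm (minus z p) ^ 2 < r / M) by nra.
    assert (M * (r / M) = r) by (field; lra). nra. }
  assert (Hnorm : forall (z : E) (eps : R), 0 < eps -> V z < m * eps ^ 2 ->
    norm (minus z p) < eps).
  { intros z eps Heps Hz. destruct (Hquad z) as [H _].
    pose proof (norm_ge_0 (minus z p)).
    apply Rnot_le_lt; intros Hle.
    assert (eps ^ 2 <= norm (minus z p) ^ 2) by nra. nra. }
  assert (Hdecay : forall (T : Rbar) (x : R -> E), solution F T x ->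
    V (x 0) < rho -> forall t : R, 0 <= t -> Rbar_lt t T ->
    V (x t) <= V (x 0) * exp (- c * t)).
  { intros T x [Hlim Hder] H0 t Ht HtT.
    apply (exponential_decay (fun t => V (x t)) (fun t => dV (x t) (F (x t)))
      T c rho); auto; try lra.
    - eapply filterlim_comp; [ exact Hlim | ].
      apply (filterdiff_continuous V). eexists; apply Hdiff.
    - intros s Hs HsT. unfold is_derive.
      (* The chain rule yields the differential [h => dV (x s) (h F (x s))]; linearity of [dV (x s)]
         pulls [h] out. *)
      apply filterdiff_ext_lin
        with (fun h : R => dV (x s) (scal h (F (x s)))).
      + apply (filterdiff_comp' x V s (fun h : R => scal h (F (x s)))).
        * apply Hder; auto.
        * apply Hdiff.
      + intros h. destruct (Hdiff (x s)) as [Hlin _].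
        apply (linear_scal _ Hlin). }
  split.
  - intros eps Heps.
    (* Below [rho] the decay applies; below [m * eps ^ 2] the norm is less than [eps]. *)
    destruct (Hsmall (Rmin rho (m * eps ^ 2))) as [delta [Hdelta Hin]].
    { apply Rmin_glb_lt; [ auto | ]. assert (0 < eps ^ 2) by nra. nra. }
    exists delta. split; [ auto | ].
    intros T x Hx H0 t Ht HtT. apply Hnorm; [ auto | ].
    pose proof (Hin _ H0) as HV.
    pose proof (Rmin_l rho (m * eps ^ 2)). pose proof (Rmin_r rho (m * eps ^ 2)).
    apply Rle_lt_trans with (V (x 0)); [ | lra ].
    apply Rle_trans with (1 := Hdecay T x Hx ltac:(lra) t Ht HtT).
    pose proof (exp_decay_le_1 c t ltac:(lra) Ht).
    pose proof (Hpos (x 0)). nra.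
  - destruct (Hsmall rho Hrho) as [delta [Hdelta Hin]].
    exists delta. split; [ auto | ].
    intros x Hx H0.
    apply (filterlim_filter_le_2 (G := locally_norm p) (H := locally p));
      [ apply locally_norm_le_locally | ].
    intros P [eps HP].
    pose proof (cond_pos eps) as Heps.
    assert (Hr : 0 < m * eps ^ 2).
    { assert (0 < eps ^ 2) by nra. nra. }
    destruct (exp_decay_lim (V (x 0)) c Hc _
      (locally_ball 0 (mkposreal _ Hr))) as [N HN].
    exists (Rmax N 0). intros t Ht.
    pose proof (Rmax_l N 0). pose proof (Rmax_r N 0).
    apply HP. apply Hnorm; [ auto | ].
    apply Rle_lt_trans with (1 := Hdecay p_infty x Hx (Hin _ H0) t ltac:(lra) I).
    assert (Hb : Rabs (V (x 0) * exp (- c * t) - 0) < m * eps ^ 2).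
    { apply HN. lra. }
    apply Rabs_def2 in Hb. lra.
Qed.

(** * Linearization and control of the remainders *)

Lemma is_derive_linear_approx (f : R -> R) (x l eta : R) :
  is_derive f x l -> 0 < eta ->
  exists delta : R, 0 < delta /\ forall y : R, Rabs (y - x) < delta ->
    Rabs (f y - f x - l * (y - x)) <= eta * Rabs (y - x).
Proof.
  intros [_ Hdom] Heta.
  destruct (Hdom x (fun P HP => HP) (mkposreal _ Heta)) as [delta Hdelta].
  exists delta. split; [ apply cond_pos | ].
  intros y Hy. rewrite (Rmult_comm l). exact (Hdelta y Hy).
Qed.

(* With [eta] this small, the remainders [e1] and [e2] cost at most half of the
   decay of the linear part. *)
Lemma lyapunov_decay_estimate (a b r mu eta x y e1 e2 : R) :
  0 < r < 1 -> 0 < mu -> mu <= a -> mu <= b -> 0 < eta ->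
  4 * (eta * (a + b)) <= mu ^ 2 ->
  Rabs e1 <= eta * Rabs x -> Rabs e2 <= eta * Rabs y ->
  a * x * (r * (- b * y + e2) - (a * x + e1))
    + r * b * y * ((- b * y + e2) + (a * x + e1))
  <= - (mu / 2) * (a / 2 * x ^ 2 + r * b * y ^ 2).
Proof.
  intros Hr Hmu Ha Hb Heta Hsmall He1 He2.
  (* Young's inequality [|z| |w| <= (z ^ 2 + w ^ 2) / 2] turns each product with a remainder into
     squares. *)
  assert (Hprod : forall z e w : R, Rabs e <= eta * Rabs w ->
    - (eta * ((z ^ 2 + w ^ 2) / 2)) <= z * e <= eta * ((z ^ 2 + w ^ 2) / 2)).
  { intros z e w He. apply Rabs_le_between. rewrite Rabs_mult.
    pose proof (Rabs_pos z). pose proof (Rabs_pos w).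
    pose proof (pow2_abs z). pose proof (pow2_abs w).
    apply Rle_trans with (eta * (Rabs z * Rabs w)); [ nra | ].
    apply Rmult_le_compat_l; [ lra | ].
    pose proof (pow2_ge_0 (Rabs z - Rabs w)). nra. }
  pose proof (Hprod x e1 x He1) as H1. pose proof (Hprod x e2 y He2) as H2.
  pose proof (Hprod y e1 x He1) as H3. pose proof (Hprod y e2 y He2) as H4.
  set (X := x ^ 2) in *. set (Y := y ^ 2) in *.
  assert (HX : 0 <= X) by apply pow2_ge_0.
  assert (HY : 0 <= Y) by apply pow2_ge_0.
  assert (Hra : 0 < r * a) by nra. assert (Hrb : 0 < r * b) by nra.
  (* The [Y] bound keeps the factor [r], to be compared with the decay [r * b ^ 2 * Y]; [r < 1]
     absorbs the term [r * a / 2 + r * b / 2] in the [X] bound. *)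
  assert (Hpert : a * (r * (x * e2) - x * e1) + r * b * (y * e2 + y * e1)
    <= 2 * (eta * (a + b)) * X + 2 * r * (eta * (a + b)) * Y).
  { apply Rle_trans with (r * a * (eta * ((X + Y) / 2)) + a * (eta * X)
      + r * b * (eta * Y) + r * b * (eta * ((X + Y) / 2))).
    - assert (r * a * (x * e2) <= r * a * (eta * ((X + Y) / 2)))
        by (apply Rmult_le_compat_l; lra).
      assert (a * (- (x * e1)) <= a * (eta * X))
        by (apply Rmult_le_compat_l; lra).
      assert (r * b * (y * e2) <= r * b * (eta * Y))
        by (apply Rmult_le_compat_l; lra).
      assert (r * b * (y * e1) <= r * b * (eta * ((X + Y) / 2)))
        by (apply Rmult_le_compat_l; lra).
      lra.
    - assert (HeX : 0 <= eta * X) by nra. assert (HeY : 0 <= eta * Y) by nra.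
      assert (0 <= (2 * (a + b) - (r * a / 2 + a + r * b / 2)) * (eta * X))
        by (apply Rmult_le_pos; [ nra | auto ]).
      assert (0 <= (2 * r * (a + b) - (r * a / 2 + r * b + r * b / 2))
        * (eta * Y)) by (apply Rmult_le_pos; [ nra | auto ]).
      lra. }
  assert (HpX : 2 * (eta * (a + b)) * X <= a ^ 2 / 2 * X)
    by (apply Rmult_le_compat_r; nra).
  assert (HpY : 2 * r * (eta * (a + b)) * Y <= r * b ^ 2 / 2 * Y).
  { apply Rmult_le_compat_r; [ auto | ].
    assert (4 * (eta * (a + b)) <= b ^ 2) by nra. nra. }
  assert (HmX : mu * (a * X) <= a * (a * X))
    by (apply Rmult_le_compat_r; nra).
  assert (HmY : mu * (r * b * Y) <= b * (r * b * Y))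
    by (apply Rmult_le_compat_r; nra).
  assert (Hlin : a * x * (r * (- b * y + e2) - (a * x + e1))
    + r * b * y * ((- b * y + e2) + (a * x + e1))
    = - a ^ 2 * X - r * b ^ 2 * Y
      + (a * (r * (x * e2) - x * e1) + r * b * (y * e2 + y * e1)))
    by (unfold X, Y; ring).
  rewrite Hlin.
  assert (0 <= a * (a * X)) by nra.
  lra.
Qed.

(** * Stability of the link queue model *)

Lemma link_queue_model_asymptotically_stable (xi a b : R) (d1 s2 : R -> R)
  (k1 k2 : R) :
  0 < xi < 1 / 2 -> 0 < a -> 0 < b ->
  is_derive d1 k1 a -> is_derive s2 k2 (- b) ->
  stationary_state (link_queue_model xi d1 s2) (k1, k2) ->
  asymptotically_stable (link_queue_model xi d1 s2) (k1, k2).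
Proof.
  intros Hxi Ha Hb Hd1 Hs2 Hstat.
  set (r := xi / (1 - xi)).
  (* The bound [r < 1] is where [xi < 1 / 2] enters. *)
  assert (Hr : 0 < r < 1).
  { unfold r. split; [ apply Rdiv_lt_0_compat; lra | ].
    apply Rmult_lt_reg_r with (1 - xi); [ lra | ].
    unfold Rdiv. rewrite Rmult_assoc, Rinv_l; lra. }
  assert (Heq1 : r * s2 k2 - d1 k1 = 0).
  { pose proof (f_equal fst Hstat) as H.
    unfold link_queue_model, L1 in H; simpl in H; fold r in H.
    unfold zero in H; simpl in H. lra. }
  assert (Heq2 : s2 k2 + d1 k1 - C3 = 0).
  { pose proof (f_equal snd Hstat) as H.
    unfold link_queue_model, L2 in H; simpl in H.
    unfold zero in H; simpl in H. lra. }
  set (mu := Rmin a b).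
  assert (Hmu : 0 < mu) by (apply Rmin_glb_lt; auto).
  assert (Hmua : mu <= a) by apply Rmin_l.
  assert (Hmub : mu <= b) by apply Rmin_r.
  set (eta := mu ^ 2 / (4 * (a + b))).
  assert (Heta : 0 < eta) by (apply Rdiv_lt_0_compat; nra).
  assert (Hsmall : 4 * (eta * (a + b)) <= mu ^ 2)
    by (right; unfold eta; field; lra).
  destruct (is_derive_linear_approx d1 k1 a eta Hd1 Heta) as [e1 [He1 Happ1]].
  destruct (is_derive_linear_approx s2 k2 (- b) eta Hs2 Heta)
    as [e2 [He2 Happ2]].
  assert (Hrb : 0 < r * b) by nra.
  set (V := fun z : R * R =>
    a / 2 * (fst z - k1) ^ 2 + r * b * (snd z - k2) ^ 2).
  set (dV := fun z h : R * R =>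
    a * (fst z - k1) * fst h + 2 * (r * b) * (snd z - k2) * snd h).
  assert (Hnorm : forall z : R * R, norm (minus z (k1, k2)) ^ 2
    = (fst z - k1) ^ 2 + (snd z - k2) ^ 2).
  { intros [x y].
    (* The norm on the product is the Euclidean one. *)
    change (sqrt (Rabs (x - k1) ^ 2 + Rabs (y - k2) ^ 2) ^ 2
      = (x - k1) ^ 2 + (y - k2) ^ 2).
    rewrite pow2_sqrt, !pow2_abs; [ reflexivity | ].
    rewrite !pow2_abs. pose proof (pow2_ge_0 (x - k1)).
    pose proof (pow2_ge_0 (y - k2)). lra. }
  (* The last constant is chosen so that [V z < rho] forces [|x - k1| < e1] and [|y - k2| < e2],
     where both linear approximations hold. *)
  apply (asymptotically_stable_of_quadratic_lyapunov _ (k1, k2) V dV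
    (Rmin (a / 2) (r * b)) (a / 2 + r * b) (mu / 2)
    (Rmin (a / 2 * e1 ^ 2) (r * b * e2 ^ 2))).
  - apply Rmin_glb_lt; lra.
  - lra.
  - lra.
  - apply Rmin_glb_lt; apply Rmult_lt_0_compat; nra.
  - intros [x y]. rewrite Hnorm. unfold V; simpl fst; simpl snd.
    pose proof (Rmin_l (a / 2) (r * b)). pose proof (Rmin_r (a / 2) (r * b)).
    pose proof (pow2_ge_0 (x - k1)). pose proof (pow2_ge_0 (y - k2)).
    rewrite !Rmult_plus_distr_l.
    split; apply Rplus_le_compat; apply Rmult_le_compat_r; lra.
  - intros [x y]. unfold V, dV.
    apply filterdiff_ext_lin with (fun u : R * R =>
      plus (scal (fst u) (a * (x - k1)))
        (scal (snd u) (2 * (r * b) * (y - k2)))).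
    + apply (is_derive_filterdiff
        (fun x y => a / 2 * (x - k1) ^ 2 + r * b * (y - k2) ^ 2) x y
        (fun x _ => a * (x - k1))).
      * exists (mkposreal 1 Rlt_0_1). intros u _.
        auto_derive; [ exact I | field ].
      * auto_derive; [ exact I | ring ].
      * apply continuous_comp with (g := fun x => a * (x - k1)).
        -- apply continuous_fst.
        -- apply (ex_derive_continuous (fun x => a * (x - k1))).
           auto_derive; exact I.
    + intros [h1 h2]. unfold plus, scal; simpl. unfold mult; simpl. ring.
  - intros [x y] HV.
    pose proof (Rmin_l (a / 2 * e1 ^ 2) (r * b * e2 ^ 2)).
    pose proof (Rmin_r (a / 2 * e1 ^ 2) (r * b * e2 ^ 2)).
    unfold V, dV, link_queue_model, L1, L2 in *; simpl fst in *;
      simpl snd in *; fold r.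
    pose proof (pow2_ge_0 (x - k1)). pose proof (pow2_ge_0 (y - k2)).
    assert (Hx : Rabs (x - k1) < e1).
    { apply Rnot_le_lt; intros Hle.
      assert (e1 ^ 2 <= (x - k1) ^ 2)
        by (rewrite <- (pow2_abs (x - k1)); apply pow_incr; lra).
      nra. }
    assert (Hy : Rabs (y - k2) < e2).
    { apply Rnot_le_lt; intros Hle.
      assert (e2 ^ 2 <= (y - k2) ^ 2)
        by (rewrite <- (pow2_abs (y - k2)); apply pow_incr; lra).
      nra. }
    pose proof (lyapunov_decay_estimate a b r mu eta (x - k1) (y - k2)
      _ _ Hr Hmu Hmua Hmub Heta Hsmall (Happ1 x Hx) (Happ2 y Hy)) as Hest.
    eapply Rle_trans; [ right | exact Hest ].
    (* The stationary equations cancel the constant terms, leaving the linear parts plus remainders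
       of the estimate. *)
    replace (d1 k1) with (r * s2 k2) by lra.
    replace C3 with (s2 k2 + r * s2 k2) by lra.
    field.
Qed.

Theorem mainTheorem5 (xi : R) (Q1 Q2 : R -> R) (k1c k1j k2c k2j : R)
  (Hxi : 1 / 3 < xi < 1 / 2)
  (HQ1 : fundamental_diagram Q1 k1c k1j)
  (HQ2 : fundamental_diagram Q2 k2c k2j)
  (Hd1 : forall k : R, 0 < k < k1c ->
    ex_derive (demand Q1 k1c) k /\ 0 < Derive (demand Q1 k1c) k)
  (Hs2 : forall k : R, k2c < k < k2j ->
    ex_derive (supply Q2 k2c) k /\ Derive (supply Q2 k2c) k < 0)
  (k1 k2 : R)
  (Hk1 : uncongested k1c k1)
  (Hk2 : congested k2c k2j k2)
  (Hstat : stationary_state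
    (link_queue_model xi (demand Q1 k1c) (supply Q2 k2c)) (k1, k2)) :
  asymptotically_stable
    (link_queue_model xi (demand Q1 k1c) (supply Q2 k2c)) (k1, k2).
Proof.
  set (s := supply Q2 k2c) in *. set (d := demand Q1 k1c) in *.
  assert (Hflows : s k2 = (1 - xi) * C3 /\ d k1 = xi * C3).
  { pose proof (f_equal fst Hstat) as H1. pose proof (f_equal snd Hstat) as H2.
    unfold link_queue_model, L1, L2 in H1, H2; simpl in H1, H2.
    unfold zero in H1, H2; simpl in H1, H2.
    assert (Hd : d k1 = xi / (1 - xi) * s k2) by lra.
    assert (Hsum : s k2 + d k1 = C3) by lra.
    assert (Hs : s k2 = (1 - xi) * C3)
      by (rewrite <- Hsum, Hd; field; lra).
    split; [ exact Hs | ]. rewrite Hd, Hs. field. lra. }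
  destruct Hflows as [Hs Hd]. unfold C3 in Hs, Hd.
  (* Zero density on link 1 would give zero demand against [xi * C3 > 0]; below, jam density on link
     2 is excluded likewise through the supply. *)
  destruct Hk1 as [[Hk1pos | <-] Hk1c].
  2: { exfalso. unfold d, demand in Hd.
       rewrite Rmin_left in Hd by lra. rewrite (fd_empty _ _ _ HQ1) in Hd. lra. }
  destruct Hk2 as [Hk2c [Hk2j | ->]].
  2: { exfalso. unfold s, supply in Hs.
       rewrite Rmax_left in Hs by lra. rewrite (fd_jam _ _ _ HQ2) in Hs. lra. }
  destruct (Hd1 k1 (conj Hk1pos Hk1c)) as [Hd1ex Hd1pos].
  destruct (Hs2 k2 (conj Hk2c Hk2j)) as [Hs2ex Hs2neg].
  apply link_queue_model_asymptotically_stable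
    with (Derive d k1) (- Derive s k2); auto; try lra.
  - apply Derive_correct, Hd1ex.
  - rewrite Ropp_involutive. apply Derive_correct, Hs2ex.
Qed.
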